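(* Let $(e_n)$ be a basis of a Banach space $X$. Then the following assertions are equivalent: (a) $(e_n)$ is almost greedy. (b) There exists a constant $C$ such that for all $x\in X$, $m\in\mathbb{N}$, $a\in\mathbb{R}$, and $A\subset\mathbb{N}$ with $|A|\le m$ and either $A<\alpha_m(x)$ or $A>\beta_m(x)$, we have $$\|x-G_m(x)\|\le C\,\|x-a1_A\|.$$
   Context: Standing setting: $X$ is a real Banach space, possibly finite-dimensional, and $(e_n)$ is a seminormalized Schauder basis of $X$ (i.e. $0<\inf_n\|e_n\|\le\sup_n\|e_n\|<\infty$), with biorthogonal functionals $(e_n^* )$. If $\dim X=N<\infty$, $(e_n)_{n=1}^N$ is an algebraic basis, all indices and index sets lie in $\{1,\dots,N\}$ instead of $\mathbb{N}$, and $m\le N$. $\mathrm{supp}(x)=\{n: e_n^*(x)\ne0\}$; for an index set $A$, $P_A(x)=\sum_{i\in A}e_i^*(x)e_i$, $1_A=\sum_{i\in A}e_i$, $|A|$ is its cardinality; for an integer $a$, $A<a$ (resp. $A>a$) means every element of $A$ is $<a$ (resp. $>a$), which holds vacuously if $A=\emptyset$. Greedy approximation: a greedy ordering for $x\in X$ is an injective map $\rho$ from the index set into itself with $\mathrm{supp}(x)$ contained in the range of $\rho$ and $|e_{\rho(j)}^*(x)|\ge|e_{\rho(k)}^*(x)|$ whenever $j<k$. Put $\Lambda_m(x)=\{\rho(1),\dots,\rho(m)\}$, $G_m(x)=\sum_{n\in\Lambda_m(x)}e_n^*(x)e_n$, $\alpha_m(x)=\min\Lambda_m(x)$, $\beta_m(x)=\max\Lambda_m(x)$.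 Statements involving $G_m(x)$, $\Lambda_m(x)$, $\alpha_m(x)$, $\beta_m(x)$ are meant for any greedy ordering of $x$ (the same ordering throughout the statement). Definition: $(e_n)$ is almost greedy if there is $C$ with $\|x-G_m(x)\|\le C\inf\{\|x-P_A(x)\| : |A|\le m\}$ for all $x\in X$, $m\in\mathbb{N}$. *)

(* Defs.v *)
From HB Require Import structures.
From mathcomp Require Import all_boot all_order all_algebra finmap.
From mathcomp Require Import all_classical all_reals all_analysis.
Set Implicit Arguments.
Unset Strict Implicit.
Unset Printing Implicit Defensive.
Import Order.TTheory GRing.Theory Num.Theory.
Import numFieldNormedType.Exports.
Local Open Scope classical_set_scope.
Local Open Scope ring_scope.

(* [dim = None] is the infinite-dimensional case, with basis (e_n) indexed by
   nat; [dim = Some N] is the case dim X = N, with basis e_0, ..., e_(N-1).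
   Indices start at 0 instead of 1.  In the finite case the values of e and
   of es at indices >= N are junk, and no definition below depends on them. *)
Definition index_set (dim : option nat) : set nat :=
  if dim is Some N then `I_N else setT.

Definition valid_size (dim : option nat) (m : nat) : bool :=
  (0 < m)%N && (if dim is Some N then (m <= N)%N else true).

Section Basis.
Context {R : realType} {X : normedModType R}.
Variables (dim : option nat) (e : nat -> X) (es : nat -> {scalar X}).

Definition expands (x : X) : Prop :=
  match dim with
  | None => series (fun n => es n x *: e n) @ \oo --> x
  | Some N => x = \sum_(0 <= n < N) es n x *: e n
  end.

(* Uniqueness of the expansion follows from biorthogonality and continuity. *)
Record schauder_basis : Prop := SchauderBasis {
  coord_continuous : forall n, index_set dim n ->
    continuous (es n : X -> R);
  coord_biorthogonal : forall i j, index_set dim i -> index_set dim j ->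
    es i (e j) = (i == j)%:R;
  coord_expands : forall x, expands x
}.

Definition seminormalized : Prop :=
  (0 < ereal_inf [set `|e n|%:E | n in index_set dim])%E /\
  (ereal_sup [set `|e n|%:E | n in index_set dim] < +oo)%E.

Definition supp (x : X) : set nat :=
  [set n | index_set dim n /\ es n x != 0].

Definition proj (A : {fset nat}) (x : X) : X := \sum_(i <- A) es i x *: e i.

Definition indicator (A : {fset nat}) : X := \sum_(i <- A) e i.

Record greedy_ordering (x : X) (rho : nat -> nat) : Prop := GreedyOrdering {
  greedy_fun : set_fun (index_set dim) (index_set dim) rho;
  greedy_inj : set_inj (index_set dim) rho;
  greedy_supp : supp x `<=` rho @` index_set dim;
  greedy_decr : forall j k, index_set dim j -> index_set dim k -> (j < k)%N ->
    `|es (rho k) x| <= `|es (rho j) x|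
}.

Definition greedy_set (rho : nat -> nat) (m : nat) : {fset nat} :=
  [fset rho j | j in iota 0 m]%fset.

Definition greedy_sum (rho : nat -> nat) (m : nat) (x : X) : X :=
  proj (greedy_set rho m) x.

(* The default value [rho 0] belongs to [greedy_set rho m] as soon as 0 < m. *)
Definition alpha (rho : nat -> nat) (m : nat) : nat :=
  \big[minn/rho 0%N]_(n <- greedy_set rho m) n.

Definition beta (rho : nat -> nat) (m : nat) : nat :=
  \max_(n <- greedy_set rho m) n.

Definition almost_greedy : Prop :=
  exists C : R, forall (x : X) (rho : nat -> nat) (m : nat),
    greedy_ordering x rho -> valid_size dim m ->
    `|x - greedy_sum rho m x| <=
      C * inf [set `|x - proj A x| | A in
                [set A : {fset nat} |
                  [set` A] `<=` index_set dim /\ (#|` A| <= m)%N]].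

End Basis.

(* Main.v *)
(* Call B a threshold set of x at level t if |e_i^*(x)| >= t on B and <= t off B.
   Both assertions are equivalent to their versions for threshold sets B in
   place of greedy sets, since x may be replaced by its partial sums: for a
   finitely supported vector an ordering listing B first is obtained by sorting.

   (a) => (b): let y = x - a 1_A, and add to B the part A1 of A where |y_i| >= t.
   This is a threshold set B' of y, so y - P_B' y and P_B' y are bounded by y.
   Since A and B are separated, P_B x is an initial or a final piece of P_B' y,
   hence bounded too.  The remainder w = a 1_A + P_A1 y has
   coordinates at most 2t on A, so (a) for w/2 + P_B x bounds w by P_B x.

   (b) => (a): let z = x - P_A x.  Then x - P_B x is the sum of z - P_(B\A) z,
   bounded by quasi-greediness, and of P_(A\B) x, whose coordinates are at most
   t.  By convexity it is enough to bound t 1_D for D inside A\B by P_(B\A) z.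
   When D and B\A are separated this is (b) for t 1_D + P_(B\A) z; cutting at
   a median of B\A reduces the general case to this one. *)
From HB Require Import structures.
Require Import Defs.
From mathcomp Require Import all_boot all_order all_algebra finmap.
From mathcomp Require Import all_classical all_reals all_analysis.
From mathcomp Require Import ring lra zify.
Import Order.TTheory GRing.Theory Num.Theory.
Import numFieldNormedType.Exports.
Local Open Scope classical_set_scope.
Local Open Scope ring_scope.

Section GreedyBasis.
Set Implicit Arguments.
Unset Strict Implicit.
Context {R : realType} {X : completeNormedModType R}.
Context {dim : option nat} {e : nat -> X} {es : nat -> {scalar X}}.
Context (he : schauder_basis dim e es).

Local Notation Idx := (index_set dim).
Local Notation proj := (Defs.proj e es).
Local Notation one := (indicator e).

(** * Coordinates, partial sums and the basis constant *)

Lemma coord_comb (A : {fset nat}) (c : nat -> R) i :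
  [set` A] `<=` Idx -> Idx i ->
  es i (\sum_(j <- A) c j *: e j) = if i \in A then c i else 0.
Proof.
move=> AI Ii; rewrite linear_sum /=.
have E j : j \in A -> es i (c j *: e j) = if j == i then c i else 0.
  move=> jA; rewrite linearZ /= (coord_biorthogonal he) //; last exact: AI.
  by rewrite eq_sym; case: eqP => [->|_] /=; rewrite ?mulr1 ?mulr0.
rewrite (eq_big_seq _ E) -big_mkcond /= big_const_seq.
rewrite count_uniq_mem ?fset_uniq //.
by case: (i \in A); rewrite //= addr0.
Qed.

Lemma coord_proj (A : {fset nat}) x i : [set` A] `<=` Idx -> Idx i ->
  es i (proj A x) = if i \in A then es i x else 0.
Proof. by move=> AI Ii; rewrite coord_comb. Qed.

Lemma coord_indicator (A : {fset nat}) i : [set` A] `<=` Idx -> Idx i ->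
  es i (one A) = if i \in A then 1 else 0.
Proof.
move=> AI Ii; rewrite -(coord_comb (fun=> 1) AI Ii).
by rewrite /indicator; congr (es i _); apply: eq_bigr => j _; rewrite scale1r.
Qed.

(** Cutting at N makes [trunc p] constant from p = N on in the finite case, so both cases share the
    limit arguments below. *)
Definition upto p : {fset nat} :=
  [fset i in iota 0 (if dim is Some N then minn p N else p)]%fset.

Lemma mem_upto p i : i \in upto p <-> (i < p)%N /\ Idx i.
Proof.
rewrite /upto /index_set; case: (dim) => [N|]; rewrite !inE mem_iota /=.
  by rewrite leq_min; split => [/andP[]|[-> ->]].
by split => [->|[]].
Qed.

Lemma upto_sub p : [set` upto p] `<=` Idx.
Proof. by move=> i /= /mem_upto[]. Qed.

Definition trunc p x := proj (upto p) x.

Lemma trunc_cvg x : trunc p x @[p --> \oo] --> x.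
Proof.
have E n (F : nat -> X) : \sum_(i <- [fset i in iota 0 n]%fset) F i
    = \sum_(0 <= i < n) F i.
  rewrite /index_iota subn0; apply: perm_big; apply: uniq_perm.
  - exact: fset_uniq.
  - exact: iota_uniq.
  - by move=> i; rewrite !inE.
have := coord_expands he x; rewrite /expands /trunc /Defs.proj /upto.
case: (dim) => [N|] H.
  apply: cvg_near_cst; exists N => // p /= Np.
  by rewrite E (minn_idPr Np).
by apply: cvg_trans H; apply: near_eq_cvg; apply: nearW => p; rewrite E.
Qed.

(** Partial sums depend on coordinates only, and they converge to the vector. Vector identities
    below are proved coordinatewise through this. *)
Lemma coord_inj x y : (forall i, Idx i -> es i x = es i y) -> x = y.
Proof.
move=> xy; apply: (cvg_unique _ (@trunc_cvg x)) => //.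
rewrite (_ : trunc ^~ x = trunc ^~ y); first exact: trunc_cvg.
apply/funext => p; rewrite /trunc /Defs.proj; apply: eq_big_seq => i iA.
by rewrite xy //; exact: upto_sub iA.
Qed.

(** Letting p tend to infinity reduces an estimate for x to its truncations, which are finitely
    supported. *)
Lemma le_norm_trunc (C : R) p0 x u v :
  (forall p, (p0 <= p)%N -> `|trunc p x - u| <= C * `|trunc p x - v|) ->
  `|x - u| <= C * `|x - v|.
Proof.
move=> H.
have cv w : `|trunc p x - w| @[p --> \oo] --> `|x - w|.
  by apply: cvg_norm; apply: cvgB; [exact: trunc_cvg|exact: cvg_cst].
apply: (ler_cvg_to (cv u)); first by apply: cvgMr; exact: cv.
by exists p0 => // p /=; exact: H.
Qed.

Lemma trunc_continuous p : continuous (trunc p : X -> X).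
Proof.
(* The induction runs over the list of [upto p]. The inclusion is carried along because [es i] is
   known to be continuous only for i in the index set. *)
have: {subset enum_fset (upto p) <= upto p} by [].
rewrite /trunc /Defs.proj; elim: (enum_fset (upto p)) => [|i s IHs] sI x.
  by apply: cvg_near_cst; apply: nearW => y; rewrite !big_nil.
have -> : (fun x => \sum_(j <- i :: s) es j x *: e j)
    = (fun x => es i x *: e i + \sum_(j <- s) es j x *: e j).
  by apply/funext => y; rewrite big_cons.
apply: cvgD; last first.
  by apply: IHs => j js; apply: sI; rewrite inE js orbT.
have Ii : Idx i by apply: upto_sub (sI i _); rewrite inE eqxx.
by apply: cvgZ; [exact: (Defs.coord_continuous he Ii)|exact: cvg_cst].
Qed.

Definition basis_constant (K : R) : Prop :=
  0 <= K /\ forall p x, `|trunc p x| <= K * `|x|.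

(** Uniform boundedness principle: [trunc p x] converges, hence is bounded for each x, and X is
    complete. The bound on the unit ball then extends by homogeneity. *)
Lemma basis_constant_ex : exists K : R, basis_constant K.
Proof.
have trunc_lin p : linear (trunc p : X -> X).
  move=> a x y; rewrite /trunc /Defs.proj scaler_sumr -big_split /=.
  by apply: eq_bigr => i _; rewrite linearP scalerDl scalerA.
pose L p : {linear X -> X} := HB.pack (trunc p : X -> X)
  (GRing.isLinear.Build _ _ _ _ _ (trunc_lin p)).
have /(_ 1)[M HM] : uniform_bounded (range (fun p => L p : X -> X)).
  apply: Banach_Steinhauss => [_ [p _ <-]|x].
    split; last exact: trunc_lin.
    rewrite /bounded_fun_norm; apply/bounded_funP/linear_bounded_continuous.
    exact: trunc_continuous.
  have /cvg_seq_bounded : cvgn (trunc ^~ x).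
    by apply/cvg_ex; exists x; exact: trunc_cvg.
  move=> [M [_ HM]]; exists (M + 1) => _ [p _ <-].
  by apply: (HM (M + 1) _ p) => //; rewrite ltrDl.
have {}HM p x : `|x| <= 1 -> `|trunc p x| <= M by apply: HM; exists p.
have truncZ p a x : trunc p (a *: x) = a *: trunc p x.
  rewrite /trunc /Defs.proj scaler_sumr; apply: eq_bigr => i _.
  by rewrite linearZ scalerA.
exists M; split=> [|p x]; first by apply: le_trans (HM 0%N 0 _); rewrite ?normr0.
have [->|x0] := eqVneq x 0; first by have := truncZ p 0 0; rewrite !scale0r => ->; rewrite !normr0 mulr0.
have := HM p (`|x|^-1 *: x).
rewrite truncZ !normrZ normfV normr_id mulVf ?normr_eq0 // lexx.
by move=> /(_ isT); rewrite mulrC ler_pdivrMr ?normr_gt0.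
Qed.

(** * Greedy sets and threshold sets *)

(* Up to ties, the sets Lambda_m(x), with the ordering forgotten. *)
Record threshold_set (x : X) (B : {fset nat}) (t : R) : Prop := ThresholdSet {
  threshold_sub : [set` B] `<=` Idx;
  threshold_ge0 : 0 <= t;
  threshold_in : forall i, i \in B -> t <= `|es i x|;
  threshold_out : forall i, Idx i -> i \notin B -> `|es i x| <= t
}.

Lemma mem_greedy_set rho m i :
  reflect (exists2 j, (j < m)%N & i = rho j) (i \in greedy_set rho m).
Proof.
apply: (iffP (imfsetP _ _ _ _)) => /= -[j]; rewrite ?mem_iota /=.
  by move=> jm ->; exists j.
by move=> jm ->; exists j; rewrite // mem_iota.
Qed.

Lemma valid_size_index m j : valid_size dim m -> (j < m)%N -> Idx j.
Proof.
rewrite /valid_size /index_set; case: (dim) => //= N /andP[_ mN] jm.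
exact: leq_trans mN.
Qed.

(** The level is the last coefficient selected. An index left out either has coordinate 0 or is
    reached by [rho] at a position at least m. *)
Lemma greedy_threshold x rho m : greedy_ordering dim es x rho ->
  valid_size dim m -> exists t, threshold_set x (greedy_set rho m) t.
Proof.
move=> g vm; have m0 : (0 < m)%N by case/andP: vm.
have Im j := @valid_size_index m j vm.
exists `|es (rho m.-1) x|; split => //.
- move=> i /= /mem_greedy_set[j jm ->]; apply: (greedy_fun g); exact: Im.
- move=> i /mem_greedy_set[j jm ->].
  have [<-//|jm1] := eqVneq j m.-1.
  by apply: (greedy_decr g); [apply: Im..|]; lia.
move=> i Ii iB; have [->|ix] := eqVneq (es i x) 0; first by rewrite normr0.
have [k Ik ki] := greedy_supp g (conj Ii ix).
rewrite -ki; apply: (greedy_decr g) => //; first by apply: Im; lia.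
rewrite prednK // leqNgt; apply: contra iB => km.
by apply/mem_greedy_set; exists k.
Qed.

Lemma card_greedy_set x rho m : greedy_ordering dim es x rho ->
  valid_size dim m -> #|` greedy_set rho m| = m.
Proof.
move=> g vm; have Im j := @valid_size_index m j vm.
rewrite card_in_imfset /= ?undup_id ?iota_uniq ?size_iota // => i j.
rewrite !mem_iota /= => im jm; apply: (greedy_inj g); rewrite inE /=; exact: Im.
Qed.

(** Sort B by decreasing modulus, then sort the rest of [upto p], and leave every later index fixed.
    All coordinates past the list vanish. *)
Lemma greedy_ordering_ex x B t p : threshold_set x B t -> (B `<=` upto p)%fset ->
  (forall i, Idx i -> i \notin upto p -> es i x = 0) ->
  exists2 rho, greedy_ordering dim es x rho & greedy_set rho #|` B| = B.
Proof.
move=> xB Bp xp.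
pose r : rel nat := fun i j => `|es j x| <= `|es i x|.
have r_total : total r by move=> i j; exact: le_total.
have r_trans : transitive r by move=> j i k; rewrite /r => h h'; exact: le_trans h' h.
pose sB := sort r B; pose sC := sort r (upto p `\` B)%fset.
pose s := sB ++ sC.
have ms i : (i \in s) = (i \in upto p).
  rewrite mem_cat !mem_sort inE; have := fsubsetP Bp i.
  by case: (i \in B) => //= ->.
have us : uniq s.
  rewrite cat_uniq !sort_uniq !fset_uniq /= andbT; apply/hasPn => i.
  by rewrite !mem_sort inE => /andP[].
(* The level t separates the coefficients on [sB] from those on [sC], so the concatenation stays
   decreasing. *)
have rs : pairwise r s.
  rewrite pairwise_cat -!sorted_pairwise // !sort_sorted // !andbT.
  apply/allrelP => i j; rewrite !mem_sort inE => iB /andP[jB jp].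
  apply: (@le_trans _ _ t); last exact: (threshold_in xB).
  by apply: (threshold_out xB) => //; exact: upto_sub jp.
(* Positions in s and entries of s both range over [upto p], so the map below permutes [upto p] and
   fixes the other indices. *)
have ssz : size s = if dim is Some N then minn p N else p.
  have /perm_size : perm_eq s (enum_fset (upto p)).
    by apply: uniq_perm; rewrite ?fset_uniq.
  by move=> ->; rewrite /upto card_fseq undup_id ?iota_uniq ?size_iota.
have ls i : (i < size s)%N = (i \in upto p).
  by rewrite ssz /upto !inE mem_iota.
(* The default value n makes the map the identity past the end of s. *)
exists (fun n => nth n s n) => /=; last first.
  apply/fsetP => i; apply/mem_greedy_set/idP => [[j jB ->]|iB].
    by rewrite nth_cat size_sort jB -(mem_sort r) mem_nth ?size_sort.
  have isB : (index i sB < size sB)%N by rewrite index_mem mem_sort.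
  exists (index i sB); first by rewrite -(size_sort r).
  by rewrite nth_cat isB nth_index ?mem_sort.
split.
- move=> n nI; case: (ltnP n (size s)) => ns; last by rewrite nth_default.
  by apply: (@upto_sub p); rewrite /= -ms mem_nth.
- move=> i j _ _; case: (ltnP i (size s)) => i_s; case: (ltnP j (size s)) => js.
  + by rewrite (set_nth_default j) // => /eqP; rewrite nth_uniq // => /eqP.
  + move=> ij; have := js; rewrite leqNgt ls -ms -(nth_default j js) -ij.
    by rewrite mem_nth.
  + move=> ij; have := i_s; rewrite leqNgt ls -ms -(nth_default i i_s) ij.
    by rewrite mem_nth.
  + by rewrite !nth_default.
- move=> i [iI xi].
  have i_s : i \in s.
    by rewrite ms; apply: contraNT xi => /(xp _ iI) ->.
  exists (index i s); last by rewrite nth_index.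
  by apply: (@upto_sub p); rewrite /= -ls index_mem.
move=> j k jI kI jk; case: (ltnP k (size s)) => ks.
  rewrite (set_nth_default j) //; apply: (pairwiseP j rs) => //.
  by rewrite inE; exact: ltn_trans ks.
rewrite [nth k s k]nth_default // xp ?normr0 //.
by rewrite -ls -leqNgt.
Qed.

Lemma upto_ex (A : {fset nat}) : [set` A] `<=` Idx ->
  exists p0, forall p, (p0 <= p)%N -> (A `<=` upto p)%fset.
Proof.
move=> AI; exists (\max_(i <- A) i).+1 => p Ap; apply/fsubsetP => i iA.
by apply/mem_upto; split; [exact: leq_ltn_trans (leq_bigmax_seq _ iA _) Ap|exact: AI].
Qed.

Lemma coord_trunc p x i : Idx i ->
  es i (trunc p x) = if i \in upto p then es i x else 0.
Proof. by move=> iI; rewrite coord_proj //; exact: upto_sub. Qed.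

Lemma proj_trunc (A : {fset nat}) p x : (A `<=` upto p)%fset ->
  proj A (trunc p x) = proj A x.
Proof.
move=> /fsubsetP Ap; apply: eq_big_seq => i /Ap iA.
by rewrite coord_trunc ?iA //; exact: upto_sub iA.
Qed.

Lemma threshold_trunc x B t p : threshold_set x B t -> (B `<=` upto p)%fset ->
  threshold_set (trunc p x) B t.
Proof.
move=> xB /fsubsetP Bp; split; [exact: threshold_sub xB|exact: threshold_ge0 xB|..].
- move=> i iB; rewrite coord_trunc; last exact: (threshold_sub xB).
  by rewrite Bp //; exact: (threshold_in xB).
- move=> i iI iB; rewrite coord_trunc //; case: ifP => _.
    exact: (threshold_out xB).
  by rewrite normr0; exact: threshold_ge0 xB.
Qed.

Lemma valid_size_card (B : {fset nat}) : [set` B] `<=` Idx -> B != fset0 ->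
  valid_size dim #|` B|.
Proof.
rewrite -cardfs_gt0 /valid_size /index_set => BI ->; move: BI.
case: (dim) => //= N BI; rewrite -[leqRHS](size_iota 0).
rewrite -(undup_id (iota_uniq 0 N)) -card_fseq; apply: fsubset_leq_card.
by apply/fsubsetP => i /BI iN; rewrite inE mem_iota.
Qed.

(** * Both assertions restated for threshold sets *)

(** The two alternatives of (b), stated elementwise so that they make sense for empty B; they hold
    trivially when A or B is empty. *)
Definition separated (A B : {fset nat}) : Prop :=
  (forall a b, a \in A -> b \in B -> (a < b)%N) \/
  (forall a b, a \in A -> b \in B -> (b < a)%N).

Definition threshold_almost_greedy (C : R) : Prop :=
  forall x B t (A : {fset nat}), threshold_set x B t -> [set` A] `<=` Idx ->
    (#|` A| <= #|` B|)%N -> `|x - proj B x| <= C * `|x - proj A x|.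

Definition threshold_separated (C : R) : Prop :=
  forall x B t (A : {fset nat}) a, threshold_set x B t -> [set` A] `<=` Idx ->
    (#|` A| <= #|` B|)%N -> separated A B ->
    `|x - proj B x| <= C * `|x - a *: one A|.

Lemma almost_greedyP : almost_greedy dim e es <->
  exists2 C : R, 1 <= C & threshold_almost_greedy C.
Proof.
split=> [[C HC]|[C C1 HC]].
  exists (Num.max 1 C); first by rewrite le_max lexx.
  move=> x B t A xB AI AB.
  (* Greedy sets have m > 0, so empty B is treated apart. Then A is empty too, and a constant at
     least 1 suffices. *)
  have [B0|B0] := eqVneq B fset0.
    have -> : A = B.
      rewrite B0; apply: cardfs0_eq; apply/eqP.
      by rewrite -leqn0 (leq_trans AB) // B0.
    by rewrite ler_peMl // le_max lexx.
  have [p1 Ap] := upto_ex AI; have [p2 Bp] := upto_ex (threshold_sub xB).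
  apply: (@le_norm_trunc _ (maxn p1 p2)) => p; rewrite geq_max => /andP[p1p p2p].
  have {}Ap := Ap p p1p; have {}Bp := Bp p p2p.
  have [rho rho_x rhoB] : exists2 rho, greedy_ordering dim es (trunc p x) rho
      & greedy_set rho #|` B| = B.
    apply: greedy_ordering_ex (threshold_trunc xB Bp) Bp _ => i iI ip.
    by rewrite coord_trunc // (negbTE ip).
  have := HC _ _ _ rho_x (valid_size_card (threshold_sub xB) B0).
  rewrite /greedy_sum rhoB !proj_trunc // => /le_trans; apply.
  set S := [set _ | _ in _].
  have S0 : lbound S 0 by move=> _ [D _ <-].
  have SA : S `|trunc p x - proj A x|.
    by exists A; [split|rewrite proj_trunc].
  (* The infimum is nonnegative, so C may be raised to [Num.max 1 C] before the infimum is compared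
     with its member given by A. *)
  apply: (@le_trans _ _ (Num.max 1 C * inf S)).
    rewrite ler_wpM2r ?le_max ?lexx ?orbT //.
    by apply: lb_le_inf => //; exists `|trunc p x - proj A x|.
  by rewrite ler_wpM2l ?le_max ?ler01 //; apply: ge_inf => //; exists 0.
exists C => x rho m rho_x vm.
have C0 : 0 < C by apply: lt_le_trans C1.
rewrite -ler_pdivrMl //; apply: lb_le_inf.
  by exists `|x - proj fset0 x|, fset0; rewrite //=; split.
move=> _ [A [AI Am] <-]; rewrite ler_pdivrMl //.
have [t xt] := greedy_threshold rho_x vm.
by apply: (HC _ _ _ _ xt) => //; rewrite (card_greedy_set rho_x vm).
Qed.

Lemma ltn_alphaP rho m n : (0 < m)%N ->
  (n < alpha rho m)%N <-> forall b, b \in greedy_set rho m -> (n < b)%N.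
Proof.
(* The minimum is at most each listed entry whatever the default, so the default is generalised
   before the induction on the list. *)
move=> m0; rewrite /alpha; split => [+ b|H].
  set r0 := rho 0%N; clearbody r0.
  suff H (s : seq nat) : (n < \big[minn/r0]_(i <- s) i)%N -> b \in s -> (n < b)%N.
    by move=> /H; apply.
  elim: s => // c s IHs.
  rewrite big_cons leq_min => /andP[nc /IHs ns].
  by rewrite inE => /predU1P[->|/ns].
rewrite big_seq; elim/big_ind: _ => //.
  by apply: H; apply/mem_greedy_set; exists 0%N.
by move=> i j; rewrite leq_min => -> ->.
Qed.

Lemma gtn_betaP rho m n : (0 < m)%N ->
  (beta rho m < n)%N <-> forall b, b \in greedy_set rho m -> (b < n)%N.
Proof.
move=> m0; rewrite /beta; split => [mn b bB|H].
  by apply: leq_ltn_trans mn; exact: leq_bigmax_seq.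
rewrite big_seq; elim/big_ind: _ => //.
  (* The base value 0 of the maximum lies below n because [rho 0], a member of the greedy set,
     does. *)
  apply: leq_ltn_trans (leq0n (rho 0%N)) _.
  by apply: H; apply/mem_greedy_set; exists 0%N.
by move=> i j; rewrite gtn_max => -> ->.
Qed.

Lemma separatedP rho m (A : {fset nat}) : (0 < m)%N ->
  ((forall n, n \in A -> (n < alpha rho m)%N) \/
   (forall n, n \in A -> (beta rho m < n)%N))
  <-> separated A (greedy_set rho m).
Proof.
move=> m0; split => -[] H; [left|right|left|right].
- by move=> a b /H /(ltn_alphaP _ _ m0); exact.
- by move=> a b /H /(gtn_betaP _ _ m0); exact.
- by move=> a aA; apply/ltn_alphaP => // b; exact: H.
- by move=> a aA; apply/gtn_betaP => // b; exact: H.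
Qed.

(** Same reduction as for [almost_greedyP], without infimum. Only x is truncated: the vector
    subtracted on the right stays fixed, so A need not lie in [upto p]. *)
Lemma threshold_separatedP :
  (exists C : R, forall x rho m (a : R) (A : {fset nat}),
    greedy_ordering dim es x rho -> valid_size dim m ->
    [set` A] `<=` Idx -> (#|` A| <= m)%N ->
    (forall n, n \in A -> (n < alpha rho m)%N) \/
    (forall n, n \in A -> (beta rho m < n)%N) ->
    `|x - greedy_sum e es rho m x| <= C * `|x - a *: one A|) <->
  exists2 C : R, 1 <= C & threshold_separated C.
Proof.
split=> [[C HC]|[C C1 HC]].
  exists (Num.max 1 C); first by rewrite le_max lexx.
  move=> x B t A a xB AI AB sAB.
  have [B0|B0] := eqVneq B fset0.
    have -> : A = fset0.
      apply: cardfs0_eq; apply/eqP.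
      by rewrite -leqn0 (leq_trans AB) // B0.
    rewrite B0 /Defs.proj /indicator !big_seq_fset0 scaler0 subr0.
    by rewrite ler_peMl // le_max lexx.
  have [p0 Bp] := upto_ex (threshold_sub xB).
  apply: (@le_norm_trunc _ p0) => p /Bp {}Bp.
  have [rho rho_x rhoB] : exists2 rho, greedy_ordering dim es (trunc p x) rho
      & greedy_set rho #|` B| = B.
    apply: greedy_ordering_ex (threshold_trunc xB Bp) Bp _ => i iI ip.
    by rewrite coord_trunc // (negbTE ip).
  have vB := valid_size_card (threshold_sub xB) B0.
  have := HC _ _ _ a A rho_x vB AI AB.
  rewrite /greedy_sum rhoB proj_trunc // => /(_ _)/le_trans; apply.
    by apply/separatedP; [case/andP: vB|rewrite rhoB].
  by rewrite ler_wpM2r // le_max lexx orbT.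
exists C => x rho m a A rho_x vm AI Am sA.
have [t xt] := greedy_threshold rho_x vm.
apply: (HC _ _ _ _ _ xt) => //; first by rewrite (card_greedy_set rho_x vm).
by apply/separatedP => //; case/andP: vm.
Qed.

(** * Separated pieces and quasi-greediness *)

Lemma proj0 x : proj fset0 x = 0.
Proof. by rewrite /Defs.proj big_seq_fset0. Qed.

Lemma proj_proj (A B : {fset nat}) x : [set` B] `<=` Idx -> (A `<=` B)%fset ->
  proj A (proj B x) = proj A x.
Proof.
move=> BI /fsubsetP AB; apply: eq_big_seq => i /AB iB.
by rewrite coord_proj ?iB //; exact: BI.
Qed.

Lemma cut_ex (A B : {fset nat}) :
  (forall a b, a \in A -> b \in B -> (a < b)%N) ->
  exists p, (forall a, a \in A -> (a < p)%N) /\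
            (forall b, b \in B -> (p <= b)%N).
Proof.
move=> AB; exists (\max_(a <- A) a.+1); split => [a aA|b bB].
  exact: (@leq_bigmax_seq _ _ xpredT succn a aA isT).
by apply/bigmax_leqP_seq => a aA _; exact: AB.
Qed.

(** With a cut p between A and B, which together carry z, [proj B z] is [trunc p z] when B comes
    first and [z - trunc p z] when A does. The constant 1 + K covers both. *)
Lemma separated_proj_le K (A B : {fset nat}) z : basis_constant K ->
  [set` A] `<=` Idx -> [set` B] `<=` Idx -> separated A B ->
  (forall i, Idx i -> i \notin A -> i \notin B -> es i z = 0) ->
  `|proj B z| <= (1 + K) * `|z|.
Proof.
move=> [K0 HK] AI BI [] H zAB.
  have [p [Ap Bp]] := cut_ex H.
  have -> : proj B z = z - trunc p z.
    apply: coord_inj => i iI; rewrite linearB /= coord_proj // coord_trunc //.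
    case: ifPn => iB.
      case: ifPn => [/mem_upto[ip _]|_]; last by rewrite subr0.
      by have := Bp _ iB; rewrite leqNgt ip.
    case: ifPn => [_|ip]; first by rewrite subrr.
    rewrite subr0 zAB //; apply: contra ip => /Ap ip.
    by apply/mem_upto.
  by rewrite mulrDl mul1r (le_trans (ler_normB _ _)) // lerD2l HK.
have [p [Bp Ap]] : exists p, (forall b, b \in B -> (b < p)%N) /\
    (forall a, a \in A -> (p <= a)%N) by apply: cut_ex => b a bB aA; exact: H.
have -> : proj B z = trunc p z.
  apply: coord_inj => i iI; rewrite coord_proj // coord_trunc //.
  case: ifPn => iB.
    by case: ifPn => // /negP[]; apply/mem_upto; split; [exact: Bp|].
  case: ifPn => // /mem_upto[ip _]; rewrite zAB //.
  by apply/negP => /Ap; rewrite leqNgt ip.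
by apply: le_trans (HK _ _) _; rewrite ler_wpM2r // lerDr.
Qed.

Lemma separated_disjoint (A B : {fset nat}) i :
  separated A B -> i \in A -> i \notin B.
Proof.
by move=> [] H iA; apply/negP => iB; have := H i i iA iB; rewrite ltnn.
Qed.

(** Both assertions give this bound on taking A empty, with a = 0 in (b). *)
Definition threshold_quasi_greedy (C : R) : Prop :=
  forall x B t, threshold_set x B t -> `|x - proj B x| <= C * `|x|.

Lemma almost_greedy_quasi_greedy C :
  threshold_almost_greedy C -> threshold_quasi_greedy C.
Proof.
move=> H x B t xB; have := H x B t fset0 xB.
by rewrite proj0 subr0; exact.
Qed.

Lemma separated_quasi_greedy C :
  threshold_separated C -> threshold_quasi_greedy C.
Proof.
move=> H x B t xB; have := H x B t fset0 0 xB.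
by rewrite scale0r subr0; apply => //; left.
Qed.

Lemma quasi_greedy_proj C x B t : threshold_quasi_greedy C ->
  threshold_set x B t -> `|proj B x| <= (1 + C) * `|x|.
Proof.
move=> H xB; rewrite -[proj B x](subKr x) mulrDl mul1r.
by rewrite (le_trans (ler_normB _ _)) // lerD2l; exact: H xB.
Qed.

(** * From (a) to (b) *)

(** In the constant, the first C bounds [y - proj B' y]. In the product, 2 C bounds w by [proj B x],
    1 + K extracts [proj B x] from [proj B' y], and 1 + C bounds [proj B' y] by y. *)
Lemma almost_greedy_separated C K : 1 <= C -> basis_constant K ->
  threshold_almost_greedy C ->
  threshold_separated (C + 2 * C * (1 + K) * (1 + C)).
Proof.
move=> C1 HK HC x B t A a xB AI AB sAB.
have BI := threshold_sub xB; have t0 := threshold_ge0 xB.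
have K0 := HK.1.
pose y := x - a *: one A.
have yE i : Idx i -> es i y = es i x - if i \in A then a else 0.
  move=> iI; rewrite linearB linearZ /= coord_indicator //.
  by case: ifP; rewrite ?mulr1 ?mulr0.
pose A1 := [fset i in A | t <= `|es i y|]%fset.
have A1E i : (i \in A1) = (i \in A) && (t <= `|es i y|) by rewrite !inE.
have A1I : [set` A1] `<=` Idx by move=> i /=; rewrite A1E => /andP[/AI].
pose B' := (B `|` A1)%fset.
have B'E i : (i \in B') = (i \in B) || (i \in A1) by rewrite in_fsetU.
have B'I : [set` B'] `<=` Idx by move=> i /=; rewrite B'E => /orP[/BI|/A1I].
have dis i : i \in A -> i \notin B by exact: separated_disjoint.
have yB' : threshold_set y B' t.
  split => // i.
    rewrite B'E => /orP[iB|]; last by rewrite A1E => /andP[].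
    rewrite yE; last exact: BI.
    rewrite ifN ?subr0; first exact: (threshold_in xB).
    by apply/negP => /dis; rewrite iB.
  move=> iI; rewrite B'E negb_or A1E => /andP[iB].
  have [iA /=|iA _] := boolP (i \in A); first by rewrite -ltNge => /ltW.
  by rewrite yE // (negbTE iA) subr0; exact: (threshold_out xB).
have QG := almost_greedy_quasi_greedy HC.
have H1 := QG _ _ _ yB'.
have H2 := quasi_greedy_proj QG yB'.
have H3 : `|proj B x| <= (1 + K) * `|proj B' y|.
  (* B is disjoint from A, so x and y agree on B. *)
  have -> : proj B x = proj B (proj B' y).
    apply: coord_inj => i iI; rewrite !coord_proj // B'E.
    case: ifPn => //= iB; rewrite yE // ifN ?subr0 //.
    by apply/negP => /dis; rewrite iB.
  apply: (separated_proj_le HK AI BI sAB) => i iI iA iB.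
  by rewrite coord_proj // B'E A1E (negbTE iA) (negbTE iB).
pose w := a *: one A + proj A1 y.
have wE i : Idx i -> es i w = if i \in A1 then es i x else if i \in A then a else 0.
  move=> iI; rewrite linearD linearZ /= coord_indicator // coord_proj // A1E.
  case: (boolP (i \in A)) => iA /=; rewrite ?mulr0 ?addr0 // mulr1.
  case: ifP; rewrite ?addr0 // yE // iA => _; ring.
(* On [A1] the coordinate of w is that of x, at most t in modulus since A misses B. On the rest of A
   it is a, which differs from a coordinate of x by less than t, so it is at most 2 t. Halving w
   thus makes B a threshold set of [x2]. *)
pose x2 := 2^-1 *: w + proj B x.
have x2E i : Idx i -> es i x2 = if i \in B then es i x else 2^-1 * es i w.
  move=> iI; rewrite linearD linearZ /= coord_proj //.
  case: ifPn => iB; rewrite ?addr0 // wE // !ifN ?mulr0 ?add0r //.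
    by apply/negP => /dis; rewrite iB.
  by rewrite A1E; apply/negP => /andP[/dis]; rewrite iB.
have wB i : Idx i -> i \in B -> es i w = 0.
  move=> iI iB; rewrite wE // A1E.
  by have [/dis|//] := boolP (i \in A); rewrite iB.
have x2B : threshold_set x2 B t.
  split => // [i iB|i iI iB].
    by rewrite x2E ?iB; [exact: (threshold_in xB)|exact: BI].
  rewrite x2E // (negbTE iB) wE // A1E.
  have := threshold_out xB iI iB.
  have [iA /=|iA _ /=] := boolP (i \in A); last by rewrite mulr0 normr0.
  case: ifPn.
    by rewrite !ler_norml => _ /andP[h1 h2]; apply/andP; split; lra.
  rewrite -ltNge yE // iA => /ltW; rewrite !ler_norml => /andP[h1 h2] /andP[h3 h4].
  by apply/andP; split; lra.
(* Removing B from [x2] leaves w/2, and removing A leaves [proj B x]. *)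
have := HC x2 B t A x2B AI AB.
have -> : x2 - proj B x2 = 2^-1 *: w.
  apply: coord_inj => i iI; rewrite linearB linearZ /= coord_proj // x2E //.
  by case: ifPn => iB; rewrite ?subr0 // wB // mulr0 subrr.
have -> : x2 - proj A x2 = proj B x.
  apply: coord_inj => i iI; rewrite linearB /= !coord_proj // x2E //.
  case: (boolP (i \in A)) => iA; first by rewrite subrr (negbTE (dis _ iA)).
  rewrite subr0; case: ifP => // iB.
  by rewrite wE // A1E (negbTE iA) mulr0.
rewrite normrZ ger0_norm ?invr_ge0 // => H4.
have -> : x - proj B x = (y - proj B' y) + w.
  apply: coord_inj => i iI; rewrite linearB linearD linearB /= !coord_proj //.
  rewrite wE // yE // B'E A1E.
  have [/dis/negbTE -> /=|iA /=] := boolP (i \in A).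
    by rewrite yE //; case: ifP => _; ring.
  by rewrite subr0 orbF addr0.
apply: le_trans (ler_normD _ _) _; rewrite mulrDl lerD //.
apply: (@le_trans _ _ (2 * C * `|proj B x|)); first by lra.
have C0 : 0 <= C by lra.
rewrite -!mulrA ler_wpM2l // ler_wpM2l // (le_trans H3) //.
by rewrite ler_wpM2l // addr_ge0.
Qed.

(** * From (b) to (a): democracy estimates and convexity *)

Lemma card_split (D : {fset nat}) n : (#|` D| <= n.*2)%N ->
  exists D1 : {fset nat}, [/\ (D1 `<=` D)%fset, (#|` D1| <= n)%N
    & (#|` (D `\` D1)%fset| <= n)%N].
Proof.
move=> Dn; pose D1 := [fset i in take n D]%fset.
have D1D : (D1 `<=` D)%fset by apply/fsubsetP => i; rewrite inE => /mem_take.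
have D1n : #|` D1| = minn n #|` D|.
  by rewrite card_fseq undup_id ?take_uniq ?fset_uniq // size_take_min.
by exists D1; split => //; rewrite ?cardfsDS // D1n; lia.
Qed.

(** If D has at most as many elements as B, apply (b) with a = t to [t *: one D + proj B z]:
    removing B leaves the first term, subtracting [t *: one D] leaves the second. Twice as many
    elements are allowed because B will be half of a larger set; D is then split in two, whence 2
    C. *)
Lemma separated_democratic C (D B : {fset nat}) z t : threshold_separated C ->
  [set` D] `<=` Idx -> [set` B] `<=` Idx -> 0 <= t ->
  (forall i, i \in B -> t <= `|es i z|) ->
  separated D B -> (#|` D| <= #|` B|.*2)%N ->
  t * `|one D| <= 2 * C * `|proj B z|.
Proof.
move=> HC DI BI t0 Bt sDB /card_split[D1 [D1D D1B D2B]].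
have small (D' : {fset nat}) : (D' `<=` D)%fset -> (#|` D'| <= #|` B|)%N ->
    t * `|one D'| <= C * `|proj B z|.
  move=> /fsubsetP D'D D'B.
  have D'I : [set` D'] `<=` Idx by move=> i /D'D /DI.
  have sD'B : separated D' B.
    by case: sDB => H; [left|right] => a b /D'D; exact: H.
  pose x := t *: one D' + proj B z.
  have xE i : Idx i -> es i x = if i \in D' then t else if i \in B then es i z else 0.
    move=> iI; rewrite linearD linearZ /= coord_indicator // coord_proj //.
    case: ifP => iD; last by rewrite mulr0 add0r.
    by rewrite (negbTE (separated_disjoint sD'B iD)) mulr1 addr0.
  have xB : threshold_set x B t.
    split => // [i iB|i iI iB]; rewrite xE //; last 2 first.
    - exact: BI.
    - by rewrite (negbTE iB); case: ifP; rewrite ?normr0 // ger0_norm.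
    case: ifP => [/(separated_disjoint sD'B)|_]; first by rewrite iB.
    by rewrite iB Bt.
  have := HC x B t D' t xB D'I D'B sD'B.
  have -> : x - proj B x = t *: one D'.
    apply: coord_inj => i iI.
    rewrite linearB linearZ /= coord_proj // coord_indicator // xE //.
    case: (boolP (i \in D')) => iD.
      by rewrite (negbTE (separated_disjoint sD'B iD)) subr0 mulr1.
    by case: ifP; rewrite mulr0 subrr.
  by rewrite /x [_ + proj B z]addrC addrK normrZ ger0_norm.
have -> : one D = one D1 + one (D `\` D1)%fset.
  apply: coord_inj => i iI; rewrite linearD /= !coord_indicator //; last 2 first.
  - by move=> j /= ; rewrite inE => /andP[_ /DI].
  - by move=> j /= /(fsubsetP D1D) /DI.
  rewrite inE; have := fsubsetP D1D i.
  case: (i \in D1) => [->//|_]; first by rewrite addr0.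
  by rewrite add0r.
have h1 := small _ D1D D1B; have h2 := small _ (fsubsetDl D D1) D2B.
have h3 := ler_wpM2l t0 (ler_normD (one D1) (one (D `\` D1)%fset)).
lra.
Qed.

(** Take the least p with at least half of B in [0, p]. By minimality fewer than half lie below p,
    so at least half lie in [p, oo); the median itself counts on both sides. *)
Lemma median_ex (B : {fset nat}) : exists p,
  (#|` B| <= #|` [fset b in B | (b <= p)%N]%fset|.*2)%N /\
  (#|` B| <= #|` [fset b in B | (p <= b)%N]%fset|.*2)%N.
Proof.
pose P p := (#|` B| <= #|` [fset b in B | (b <= p)%N]%fset|.*2)%N.
have Pex : exists p, P p.
  exists (\max_(b <- B) b); rewrite /P.
  suff -> : [fset b in B | (b <= \max_(b <- B) b)%N]%fset = B.
    by rewrite -addnn leq_addr.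
  apply/fsetP => b; rewrite !inE; case: (boolP (b \in B)) => //= bB.
  exact: leq_bigmax_seq.
case: (ex_minnP Pex) => p Pp minp; exists p; split => //.
case: p Pp minp => [|p] _ minp.
  suff -> : [fset b in B | (0 <= b)%N]%fset = B by rewrite -addnn leq_addr.
  by apply/fsetP => b; rewrite !inE andbT.
have : ~~ P p by apply/negP => /minp; rewrite ltnn.
rewrite /P -ltnNge.
set B1 := [fset b in B | _]%fset; set B2 := [fset b in B | (p < b)%N]%fset.
suff : (#|` B| <= #|` B1| + #|` B2|)%N by lia.
apply: leq_trans (leq_card_fsetU B1 B2).1; apply: fsubset_leq_card.
by apply/fsubsetP => b bB; rewrite !inE bB /=; case: leqP.
Qed.

(** The part of D up to the median is compared with the upper half of B, the part above it with the
    lower half. Each comparison costs 2 C, and each half of B, a final or initial piece, costs 1 +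
    K. *)
Lemma disjoint_democratic C K (D B : {fset nat}) z t : 1 <= C ->
  basis_constant K -> threshold_separated C ->
  [set` D] `<=` Idx -> [set` B] `<=` Idx -> 0 <= t ->
  (forall i, i \in B -> t <= `|es i z|) ->
  (forall i, i \in D -> i \notin B) -> (#|` D| <= #|` B|)%N ->
  t * `|one D| <= 4 * C * (1 + K) * `|proj B z|.
Proof.
move=> C1 HK HC DI BI t0 Bt disj DB; have [p [pB1 pB2]] := median_ex B.
have half (B1 : {fset nat}) : (B1 `<=` B)%fset ->
    separated (B `\` B1)%fset B1 -> `|proj B1 z| <= (1 + K) * `|proj B z|.
  move=> B1B sB1; rewrite -(proj_proj z BI B1B).
  apply: (separated_proj_le HK _ _ sB1).
  - by move=> i /=; rewrite inE => /andP[_ /BI].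
  - by move=> i /= /(fsubsetP B1B) /BI.
  - move=> i iI; rewrite inE negb_and negbK => /orP[->//|iB] _.
    by rewrite coord_proj // (negbTE iB).
set B1 := [fset b in B | (b <= p)%N]%fset in pB1.
set B2 := [fset b in B | (p <= b)%N]%fset in pB2.
have B1B : (B1 `<=` B)%fset by apply/fsubsetP => i; rewrite !inE => /andP[].
have B2B : (B2 `<=` B)%fset by apply/fsubsetP => i; rewrite !inE => /andP[].
have hB1 : `|proj B1 z| <= (1 + K) * `|proj B z|.
  apply: half => //; right => a b; rewrite !inE => /andP[+ aB] /andP[_ bp].
  by rewrite aB /= -ltnNge; exact: leq_ltn_trans.
have hB2 : `|proj B2 z| <= (1 + K) * `|proj B z|.
  apply: half => //; left => a b; rewrite !inE => /andP[+ aB] /andP[_ bp].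
  by rewrite aB /= -ltnNge => ap; exact: leq_trans bp.
pose D1 := [fset d in D | (d <= p)%N]%fset.
pose D2 := [fset d in D | (p < d)%N]%fset.
have D1D : (D1 `<=` D)%fset by apply/fsubsetP => i; rewrite !inE => /andP[].
have D2D : (D2 `<=` D)%fset by apply/fsubsetP => i; rewrite !inE => /andP[].
have sub (A A' : {fset nat}) : (A `<=` A')%fset -> [set` A'] `<=` Idx -> [set` A] `<=` Idx.
  by move=> /fsubsetP AA' A'I i /AA' /A'I.
have h1 : t * `|one D1| <= 2 * C * `|proj B2 z|.
  apply: separated_democratic => //; [exact: sub DI|exact: sub BI|..].
  - by move=> i /(fsubsetP B2B); exact: Bt.
  (* Here d <= p <= b, and equality d = b is excluded because D and B are disjoint. *)
  - left => d b; rewrite !inE => /andP[dD dp] /andP[bB pb].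
    rewrite ltn_neqAle (leq_trans dp pb) andbT.
    by apply: contraTneq bB => <-; exact: disj.
  - by apply: leq_trans pB2; apply: leq_trans DB; exact: fsubset_leq_card.
have h2 : t * `|one D2| <= 2 * C * `|proj B1 z|.
  apply: separated_democratic => //; [exact: sub DI|exact: sub BI|..].
  - by move=> i /(fsubsetP B1B); exact: Bt.
  - right => d b; rewrite !inE => /andP[dD pd] /andP[bB bp].
    exact: leq_ltn_trans pd.
  - by apply: leq_trans pB1; apply: leq_trans DB; exact: fsubset_leq_card.
have -> : one D = one D1 + one D2.
  apply: coord_inj => i iI; rewrite linearD /= !coord_indicator //; last 2 first.
  - exact: sub DI.
  - exact: sub DI.
  rewrite !inE; case: (i \in D) => /=; last by rewrite addr0.
  by case: leqP; rewrite ?addr0 ?add0r.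
have h3 := ler_wpM2l t0 (ler_normD (one D1) (one D2)).
have C0 : 0 <= 2 * C by lra.
have h4 := ler_wpM2l C0 hB1; have h5 := ler_wpM2l C0 hB2.
lra.
Qed.

(* A point of a cube is a convex combination of the vertices; the vertices are
   the subsequences of [s]. *)
Lemma norm_comb_le (s : seq nat) (v : X) (t M : R) (c : nat -> R) :
  (forall s', subseq s' s -> `|v + t *: (\sum_(i <- s') e i)| <= M) ->
  (forall i, i \in s -> 0 <= c i <= 1) ->
  `|v + t *: (\sum_(i <- s) c i *: e i)| <= M.
Proof.
elim: s v => [|j s IHs] v HM c01.
  by have := HM [::] isT; rewrite !big_nil.
have c01s i : i \in s -> 0 <= c i <= 1 by move=> h; apply: c01; rewrite inE h orbT.
have /andP[c0 c1] := c01 j (mem_head _ _).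
have h1 : `|(v + t *: e j) + t *: (\sum_(i <- s) c i *: e i)| <= M.
  apply: IHs => // s' ss'; rewrite -addrA -scalerDr.
  by have := HM (j :: s'); rewrite /= eqxx big_cons; exact.
have h2 : `|v + t *: (\sum_(i <- s) c i *: e i)| <= M.
  by apply: IHs => // s' ss'; apply: HM; exact: subseq_trans (subseq_cons _ _).
move: h1 h2; rewrite big_cons; set u := \sum_(i <- s) _ => h1 h2.
(* The point is a convex combination of the points with j-th coefficient 1 and 0, bounded in [h1]
   and [h2]. *)
have -> : v + t *: (c j *: e j + u) =
    c j *: ((v + t *: e j) + t *: u) + (1 - c j) *: (v + t *: u).
  have -> : v + t *: (c j *: e j + u) = v + t *: u + c j *: (t *: e j).
    by rewrite scalerDr addrA addrAC !scalerA [t * c j]mulrC.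
  rewrite [v + _ + t *: u]addrAC; move: (v + t *: u) => y.
  by rewrite scalerDr scalerBl scale1r [RHS]addrAC [c j *: y + _]addrC subrK.
rewrite (le_trans (ler_normD _ _)) // !normrZ !ger0_norm ?subr_ge0 //.
have h3 := ler_wpM2l c0 h1; have h4 : 0 <= 1 - c j by rewrite subr_ge0.
have h5 := ler_wpM2l h4 h2.
lra.
Qed.

(** The coefficients on D lie in [-t, t], a cube with vertices [- t *: one D + (2 * t) *: one D']
    for subsets D' of D. Democracy for D and D' bounds each vertex, and 12 = (1 + 2) * 4. *)
Lemma disjoint_proj_le C K (D B : {fset nat}) x z t : 1 <= C ->
  basis_constant K -> threshold_separated C ->
  [set` D] `<=` Idx -> [set` B] `<=` Idx -> 0 <= t ->
  (forall i, i \in B -> t <= `|es i z|) ->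
  (forall i, i \in D -> `|es i x| <= t) ->
  (forall i, i \in D -> i \notin B) -> (#|` D| <= #|` B|)%N ->
  `|proj D x| <= 12 * C * (1 + K) * `|proj B z|.
Proof.
move=> C1 HK HC DI BI t0 Bt Dt disj DB.
pose c i := (es i x / t + 1) / 2.
have cE i : i \in D -> es i x = - t + 2 * t * c i.
  (* For t = 0 the coordinate vanishes, and the formula holds whatever [c i] is. *)
  move=> /Dt; rewrite /c; have [->|tn0] := eqVneq t 0.
    by rewrite normr_le0 => /eqP ->; rewrite mulr0 mul0r oppr0 addr0.
  by move=> _; field.
have c01 i : i \in D -> 0 <= c i <= 1.
  move=> iD; suff : -1 <= es i x / t <= 1 by rewrite /c; lra.
  rewrite -ler_norml normrM normfV (ger0_norm t0).
  have [->|tn0] := eqVneq t 0; first by rewrite invr0 mulr0.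
  by rewrite ler_pdivrMr ?mul1r ?Dt // lt_def tn0.
have -> : proj D x = - t *: one D + (2 * t) *: (\sum_(i <- D) c i *: e i).
  rewrite /indicator !scaler_sumr -big_split /=; apply: eq_big_seq => i iD.
  by rewrite {1}cE // scalerDl scalerA.
apply: norm_comb_le c01 => s' s'D.
pose D' := [fset i in s']%fset.
have -> : \sum_(i <- s') e i = one D'.
  apply: perm_big; apply: uniq_perm; rewrite ?fset_uniq //.
    by apply: subseq_uniq s'D _; exact: fset_uniq.
  by move=> i; rewrite inE.
have D'D : (D' `<=` D)%fset.
  by apply/fsubsetP => i; rewrite inE => /(mem_subseq s'D).
have dem (A : {fset nat}) : (A `<=` D)%fset ->
    t * `|one A| <= 4 * C * (1 + K) * `|proj B z|.
  move=> AD; apply: disjoint_democratic => //.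
  - by move=> i /(fsubsetP AD) /DI.
  - by move=> i /(fsubsetP AD); exact: disj.
  - by apply: leq_trans DB; exact: fsubset_leq_card.
have h1 := dem _ (fsubset_refl D); have h2 := dem _ D'D.
rewrite (le_trans (ler_normD _ _)) // !normrZ normrN !ger0_norm //.
lra.
Qed.

(** In the constant, the first C bounds [z - proj B0 z]. In the product, 12 C (1 + K) bounds
    [proj D x] by [proj B0 z], and 1 + C bounds [proj B0 z] by z. *)
Lemma separated_almost_greedy C K : 1 <= C -> basis_constant K ->
  threshold_separated C ->
  threshold_almost_greedy (C + 12 * C * (1 + K) * (1 + C)).
Proof.
move=> C1 HK HC x B t A xB AI AB.
have BI := threshold_sub xB; have t0 := threshold_ge0 xB; have K0 := HK.1.
pose z := x - proj A x.
have zE i : Idx i -> es i z = if i \in A then 0 else es i x.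
  by move=> iI; rewrite linearB /= coord_proj //; case: ifP; rewrite ?subrr ?subr0.
pose B0 := (B `\` A)%fset; pose D := (A `\` B)%fset.
have B0I : [set` B0] `<=` Idx by move=> i /=; rewrite inE => /andP[_ /BI].
have DI : [set` D] `<=` Idx by move=> i /=; rewrite inE => /andP[_ /AI].
have zB0 : threshold_set z B0 t.
  split => // [i|i iI]; rewrite inE.
    move=> /andP[iA iB]; rewrite zE ?(negbTE iA); last exact: BI.
    exact: (threshold_in xB).
  rewrite zE // negb_and negbK; case: (boolP (i \in A)) => [_ _|iA /= iB].
    by rewrite normr0.
  exact: (threshold_out xB).
have QG := separated_quasi_greedy HC.
have H1 := QG _ _ _ zB0; have H2 := quasi_greedy_proj QG zB0.
have H3 : `|proj D x| <= 12 * C * (1 + K) * `|proj B0 z|.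
  apply: (disjoint_proj_le C1 HK HC DI B0I t0).
  - exact: (threshold_in zB0).
  - by move=> i; rewrite inE => /andP[iB /AI iI]; exact: (threshold_out xB).
  - by move=> i; rewrite !inE => /andP[_ ->].
  (* Adding the common part of A and B to both sides turns the comparison of D with [B0] into that
     of A with B. *)
  - rewrite -(leq_add2l #|` (A `&` B)%fset|) cardfsID fsetIC cardfsID.
    exact: AB.
have -> : x - proj B x = (z - proj B0 z) + proj D x.
  clearbody z; apply: coord_inj => i iI.
  rewrite [RHS]linearD !linearB /= !coord_proj // zE // !inE.
  by case: (i \in A); case: (i \in B) => /=; ring.
apply: le_trans (ler_normD _ _) _; rewrite mulrDl lerD //.
apply: le_trans H3 _; rewrite -[leRHS]mulrA ler_wpM2l //.
by rewrite !mulr_ge0 ?addr_ge0 // (le_trans ler01).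
Qed.

End GreedyBasis.

(** * The equivalence *)

Theorem theorem2p16 (R : realType) (X : completeNormedModType R)
    (dim : option nat) (e : nat -> X) (es : nat -> {scalar X})
    (he : schauder_basis dim e es) (hn : seminormalized dim e) :
  almost_greedy dim e es <->
  (exists C : R, forall (x : X) (rho : nat -> nat) (m : nat) (a : R)
      (A : {fset nat}),
    greedy_ordering dim es x rho ->
    valid_size dim m ->
    [set` A] `<=` index_set dim ->
    (#|` A| <= m)%N ->
    (forall n, n \in A -> (n < alpha rho m)%N) \/
    (forall n, n \in A -> (beta rho m < n)%N) ->
    `|x - greedy_sum e es rho m x| <= C * `|x - a *: indicator e A|).
Proof.
have [K HK] := basis_constant_ex he; have K0 := HK.1.
apply: iff_trans (almost_greedyP he) (iff_trans _ (iff_sym (threshold_separatedP he))).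
split=> -[C C1 HC].
(* The new constant is at least C, hence at least 1, as the threshold form requires. *)
- exists (C + 2 * C * (1 + K) * (1 + C)).
    by rewrite (le_trans C1) // lerDl !mulr_ge0 ?addr_ge0 // (le_trans ler01).
  exact: almost_greedy_separated.
- exists (C + 12 * C * (1 + K) * (1 + C)).
    by rewrite (le_trans C1) // lerDl !mulr_ge0 ?addr_ge0 // (le_trans ler01).
  exact: separated_almost_greedy.
Qed.
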